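(* There exist constants $c,C>0$ such that for every even $n$ there is a partial Boolean function $f:S\to\{0,1\}$ with $S\subseteq\{0,1\}^n$ satisfying $\mathrm{fbs}(f)\le C$ and $\mathrm{CA}_1(f),\mathrm{CA}(f),\mathrm{WA}(f),\mathrm{KA}(f),\mathrm{MM}(f)\ge c\,n$ (that is, $\mathrm{fbs}(f)=O(1)$ while all these adversary bounds are $\Omega(n)$).
   Context: For $x\in S$, $x_i$ is its $i$-th bit. Sensitive block of $x$: $B=\{i:x_i\neq y_i\}$ for some $y\in S$ with $f(y)\ne f(x)$; $\mathrm{fbs}(f,x)=\max\sum_B w(B)$ over weights $w\in[0,1]$ on sensitive blocks of $x$ with $\sum_{B\ni i}w(B)\le1$ for all $i$; $\mathrm{fbs}(f)=\max_x\mathrm{fbs}(f,x)$. $\mathrm{CA}(f)$: for symmetric $R:S\times S\to\mathbb{R}_{\ge0}$, not identically zero, with $R(x,y)=0$ when $f(x)=f(y)$, let $\theta(x,i)=\sum_yR(x,y)/\sum_{y:x_i\ne y_i}R(x,y)$; $\mathrm{CA}(f)=\max_R\min_{R(x,y)>0,x_i\ne y_i}\max\{\theta(x,i),\theta(y,i)\}$. $\mathrm{CA}_1(f)$ is the same maximum restricted to $R(x,y)=\max\{u(x)v(y),u(y)v(x)\}$ with $u,v:S\to\mathbb{R}_{\ge0}$, $u(x)v(y)=0$ whenever $f(x)=f(y)$. $\mathrm{WA}(f)$: weights $w(x,y)=w(y,x)\ge0$, zero when $f(x)=f(y)$; $w'(x,y,i)\ge0$, zero when $x_i=y_i$ or $f(x)=f(y)$,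 with $w'(x,y,i),w'(y,x,i)\ge w(x,y)$ when $x_i\ne y_i$; $wt(x)=\sum_yw(x,y)$, $v(x,i)=\sum_yw'(x,y,i)$; $\mathrm{WA}(f)=\max_{w,w'}\min_{w(x,y)\ne0,x_i\ne y_i}\max\{wt(x)/v(x,i),wt(y)/v(y,i)\}$. $\mathrm{KA}(f)=\min_{\sigma\in\{0,1\}^*}\max_{f(x)\ne f(y)}\big(\sum_{i:x_i\ne y_i}\min\{2^{-K(i|x,\sigma)},2^{-K(i|y,\sigma)}\}\big)^{-1}$, where $K(i\mid x,\sigma)$ is prefix-free Kolmogorov complexity with respect to a fixed universal Turing machine and prefix-free program set. $\mathrm{MM}(f)=\min_{\{p_x\}}\max_{f(x)\ne f(y)}\big(\sum_{i:x_i\ne y_i}\min\{p_x(i),p_y(i)\}\big)^{-1}$ over families of probability distributions $p_x$ on $[n]$. *)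

(* Defs.v *)
From HB Require Import structures.
From mathcomp Require Import all_boot all_order all_algebra.
From mathcomp Require Import all_classical all_reals all_analysis.

Set Implicit Arguments.
Unset Strict Implicit.
Unset Printing Implicit Defensive.

Import Order.TTheory GRing.Theory Num.Theory.

Local Open Scope classical_set_scope.
Local Open Scope ring_scope.

Definition dom n (S : {set n.-tuple bool}) := {x : n.-tuple bool | x \in S}.

Definition bit n (S : {set n.-tuple bool}) (x : dom S) (i : 'I_n) : bool :=
  tnth (val x) i.

(** Maxima and minima over possibly infinite families are rendered as suprema
    and infima in [\bar R]; in particular a maximum over an empty family is
    [-oo] and a minimum over an empty family is [+oo]. *)

Section Measures.
Variables (R : realType) (n : nat) (S : {set n.-tuple bool}) (f : dom S -> bool).

Definition diff_block (x y : dom S) : {set 'I_n} :=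
  finset (fun i => bit x i != bit y i).

Definition sensitive_block (x : dom S) (B : {set 'I_n}) : bool :=
  [exists y, (f y != f x) && (B == diff_block x y)].

Definition block_weights (x : dom S) : set ({set 'I_n} -> R) :=
  [set w | (forall B, sensitive_block x B -> 0 <= w B <= 1) /\
           (forall i, \sum_(B | sensitive_block x B && (i \in B)) w B <= 1)].

Definition fbs_at (x : dom S) : \bar R :=
  ereal_sup [set (\sum_(B | sensitive_block x B) w B)%:E
            | w in block_weights x].

Definition fbs : \bar R := ereal_sup (range fbs_at).

Definition CA_relations : set (dom S -> dom S -> R) :=
  [set r | [/\ forall x y, r x y = r y x,
               forall x y, 0 <= r x y,
               exists x y, r x y != 0 &
               forall x y, f x = f y -> r x y = 0]].

Definition CA1_relations : set (dom S -> dom S -> R) :=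
  CA_relations `&`
  [set r | exists u v : dom S -> R,
    [/\ forall x, 0 <= u x,
        forall x, 0 <= v x,
        forall x y, f x = f y -> u x * v y = 0 &
        forall x y, r x y = Num.max (u x * v y) (u y * v x)]].

(** In [CA_value], the denominators of [theta r x i] and [theta r y i] are both
    at least [r x y > 0]. *)
Definition theta (r : dom S -> dom S -> R) (x : dom S) (i : 'I_n) : R :=
  (\sum_y r x y) / (\sum_(y | bit x i != bit y i) r x y).

Definition CA_value (r : dom S -> dom S -> R) : \bar R :=
  ereal_inf [set e | exists x y i, [/\ 0 < r x y, bit x i != bit y i &
                       e = (Num.max (theta r x i) (theta r y i))%:E]].

Definition CA : \bar R := ereal_sup [set CA_value r | r in CA_relations].

Definition CA1 : \bar R := ereal_sup [set CA_value r | r in CA1_relations].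

(** [w] is required not to vanish identically: otherwise the minimum in
    [WA_value] would range over the empty set, making [WA] infinite. *)
Definition WA_schemes :
    set ((dom S -> dom S -> R) * (dom S -> dom S -> 'I_n -> R)) :=
  [set W | let: (w, w') := W in
    [/\ forall x y, w x y = w y x /\ 0 <= w x y,
        exists x y, w x y != 0,
        forall x y, f x = f y -> w x y = 0,
        forall x y i, 0 <= w' x y i /\
          (bit x i = bit y i \/ f x = f y -> w' x y i = 0) &
        forall x y i, bit x i != bit y i ->
          w x y <= w' x y i /\ w x y <= w' y x i]].

Definition wt (w : dom S -> dom S -> R) (x : dom S) : R := \sum_y w x y.

Definition vt (w' : dom S -> dom S -> 'I_n -> R) (x : dom S) (i : 'I_n) : R :=
  \sum_y w' x y i.

(** As for [theta], the denominators below are at least [w x y > 0]. *)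
Definition WA_value
    (W : (dom S -> dom S -> R) * (dom S -> dom S -> 'I_n -> R)) : \bar R :=
  let: (w, w') := W in
  ereal_inf [set e | exists x y i, [/\ w x y != 0, bit x i != bit y i &
    e = (Num.max (wt w x / vt w' x i) (wt w y / vt w' y i))%:E]].

Definition WA : \bar R := ereal_sup [set WA_value W | W in WA_schemes].

(** For a family [g] of nonnegative functions on the indices. The inverse is
    the one of [\bar R], so that [0^-1 = +oo]. *)
Definition minimax_value (g : dom S -> 'I_n -> R) : \bar R :=
  ereal_sup [set e | exists x y, f x != f y /\
    e = ((\sum_(i | bit x i != bit y i) Num.min (g x i) (g y i))%:E ^-1)%E].

Definition distributions : set (dom S -> 'I_n -> R) :=
  [set p | forall x, (forall i, 0 <= p x i) /\ \sum_i p x i = 1].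

Definition MM : \bar R := ereal_inf [set minimax_value p | p in distributions].

End Measures.

Inductive symbol := Blank | Sep | Bit of bool.

Inductive move := MoveL | Stay | MoveR.

(** Deterministic machines with one two-way infinite tape, indexed by [int];
    a transition to [None] means halting. *)
Record machine := Machine {
  state : finType;
  start : state;
  delta : state -> symbol -> option (state * symbol * move)
}.

Record config (M : machine) := Config {
  cstate : state M;
  ctape : int -> symbol;
  chead : int
}.

Definition shift (m : move) (k : int) : int :=
  match m with MoveL => k - 1 | Stay => k | MoveR => k + 1 end.

Definition step (M : machine) (c : config M) : config M :=
  if delta (cstate c) (ctape c (chead c)) is Some (q, a, m) then
    Config q (fun k => if k == chead c then a else ctape c k)
           (shift m (chead c))
  else c.

Definition halted (M : machine) (c : config M) : Prop :=
  delta (cstate c) (ctape c (chead c)) = None.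

(** The tape initially holds program, condition [x], condition [s], separated
    by [Sep], starting at the head position. *)
Definition input (p x s : seq bool) : seq symbol :=
  map Bit p ++ Sep :: map Bit x ++ Sep :: map Bit s.

Definition init (M : machine) (p x s : seq bool) : config M :=
  Config (start M)
    (fun k => if k is Posz m then nth Blank (input p x s) m else Blank) 0.

(** The output is the maximal block of bits starting at the head position. *)
Definition output (M : machine) (c : config M) (z : seq bool) : Prop :=
  (forall j, (j < size z)%N ->
     ctape c (chead c + j%:Z) = Bit (nth false z j)) /\
  (forall b, ctape c (chead c + (size z)%:Z) <> Bit b).

Definition halts (M : machine) (p x s : seq bool) : Prop :=
  exists k, halted (iter k (@step M) (init M p x s)).

Definition computes (M : machine) (p x s z : seq bool) : Prop :=
  exists k, let c := iter k (@step M) (init M p x s) in halted c /\ output c z.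

Definition prefix_free (P : set (seq bool)) : Prop :=
  forall p q, P p -> P q -> prefix p q -> p = q.

Definition computably_enumerable (P : set (seq bool)) : Prop :=
  exists D : machine, P = [set p | halts D p [::] [::]].

(** Every machine [M] reading its programs from a computably enumerable
    prefix-free set [Q] is simulated by [U] on programs from [P], at the cost
    of prepending a fixed string [e]. Since [e] works for all [q], whether or
    not [q] lies in [Q], [U] is a universal machine in the usual sense. *)
Definition universal (U : machine) (P : set (seq bool)) : Prop :=
  [/\ prefix_free P,
      computably_enumerable P &
      forall (M : machine) (Q : set (seq bool)),
        prefix_free Q -> computably_enumerable Q ->
        exists e : seq bool,
          (forall q, Q q -> P (e ++ q)) /\
          (forall q x s z, computes U (e ++ q) x s z <-> computes M q x s z)].

(** The standard bijection between strings and naturals: the string [z] stands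
    for [m] when [1z] is the binary numeral of [m + 1]. *)
Definition nat_of_str (z : seq bool) : nat :=
  (foldl (fun m (b : bool) => b + m.*2) 1 z)%N.-1.

Section Kolmogorov.
Variables (R : realType) (U : machine) (P : set (seq bool)).

(** K(m | x, s), equal to [+oo] if no program outputs [m]. *)
Definition Kcond (m : nat) (x s : seq bool) : \bar R :=
  ereal_inf [set ((size p)%:R : R)%:E
    | p in [set p | P p /\ exists2 z, computes U p x s z & nat_of_str z = m]].

Definition pow2N (k : \bar R) : R := if k is r%:E then 2 `^ (- r) else 0.

(** Indices are numbered from 1, whence [i.+1]. *)
Definition KA n (S : {set n.-tuple bool}) (f : dom S -> bool) : \bar R :=
  ereal_inf [set minimax_value f
                   (fun (x : dom S) (i : 'I_n) => pow2N (Kcond i.+1 (val x) s))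
            | s in [set: seq bool]].

End Kolmogorov.

(* Main.v *)
(** Let [n = 2m], let the domain consist of the [n] unit vectors, and let
    [f (e_i) = 1] iff [i] lies in the lower half of the indices. Two unit
    vectors [e_i], [e_j] differ exactly at [i] and [j], so all sensitive blocks
    of [e_i] share the index [i], whence [fbs f <= 1]. Giving weight [1] to all
    pairs with different values yields [CA1 f >= m]: only one such neighbour
    [e_j] of [e_i] has bit [j] set. For the minimax bounds, let [g x] be
    nonnegative of total mass at most [1] for every [x]; averaging over the
    [m^2] pairs [(e_i, e_j)] of different value, some pair has
    [g e_i j + g e_j i <= 2 / m]. This covers [MM] by taking distributions, and
    [KA] since [2^-K(i | x, s)] sums to at most [1] by Kraft's inequality. *)

Require Import Defs.
From mathcomp Require Import all_boot all_order all_algebra.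
From mathcomp Require Import all_classical all_reals all_analysis.
From mathcomp Require Import lra.

Set Implicit Arguments.
Unset Strict Implicit.
Unset Printing Implicit Defensive.

Import Order.TTheory GRing.Theory Num.Theory.

Local Open Scope classical_set_scope.
Local Open Scope ring_scope.

(** * Kraft's inequality *)

Lemma prefix_free_cons (P : set (seq bool)) (b : bool) :
  prefix_free P -> prefix_free [set q | P (b :: q)].
Proof.
move=> hP p q Pp Pq pq.
have := hP (b :: p) (b :: q) Pp Pq.
by rewrite prefix_cons eqxx pq => /(_ isT) [].
Qed.

(** Induction on a bound for the program lengths: programs with first bit [b], once it is removed,
    again form a prefix-free family, so each value of [b] contributes at most one half. *)
Lemma kraft (R : realType) (P : set (seq bool)) (I : finType) (A : pred I)
    (p : I -> seq bool) :
  prefix_free P -> (forall i, A i -> P (p i)) -> {in A &, injective p} ->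
  \sum_(i | A i) (2^-1 : R) ^+ size (p i) <= 1.
Proof.
set N := (\max_i size (p i))%N.
have : forall i, A i -> (size (p i) <= N)%N by move=> i _; exact: leq_bigmax.
move: N => N; elim: N => [|N IHN] in P A p *; move=> sz hP Pp p_inj;
  have [/existsP[i /andP[Ai /eqP pi0]]|/existsPn no0] :=
    boolP [exists i, A i && (p i == [::])].
(* The empty program is a prefix of every other, so [i] is then the only index and the sum is 1. *)
1,3: rewrite (big_pred1 i) ?pi0// => j; apply/idP/eqP => [Aj|->//];
     apply: p_inj => //; apply/esym/hP;
     [exact: Pp|exact: Pp|by rewrite pi0 prefix0s].
- rewrite big_pred0 ?ler01// => i; apply/negP => Ai.
  by have := no0 i; rewrite Ai -size_eq0 -leqn0 sz.
have pE i b : A i && (head false (p i) == b) -> p i = b :: behead (p i).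
  move=> /andP[Ai /eqP <-]; have := no0 i; rewrite Ai/=.
  by case: (p i).
have half b : \sum_(i | A i && (head false (p i) == b)) (2^-1 : R) ^+ size (p i)
    <= 2^-1.
  have : \sum_(i | A i && (head false (p i) == b))
      (2^-1 : R) ^+ size (behead (p i)) <= 1.
    apply: (IHN [set q | P (b :: q)]).
    - move=> i Ai; have /andP[/sz] := Ai; rewrite (pE i b Ai)//.
    - exact: prefix_free_cons.
    - by move=> i Ai /=; rewrite -pE//; apply: Pp; case/andP: Ai.
    - move=> i j Ai Aj pij; apply: p_inj; first by case/andP: Ai.
        by case/andP: Aj.
      by rewrite (pE i b Ai) (pE j b Aj) pij.
  rewrite -(ler_pM2l (_ : 0 < 2^-1 :> R)) ?invr_gt0// mulr1; apply: le_trans.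
  rewrite mulr_sumr; apply: ler_sum => i Ai.
  by rewrite [in leLHS](pE i b Ai)/= exprS.
rewrite (bigID (fun i => head false (p i) == true))/=.
have h0 := half true.
have h1 := half false.
rewrite (eq_bigl (fun i => A i && (head false (p i) != true))) in h1; first lra.
by move=> i; case: (head _ _).
Qed.

(** * Determinism of machines *)

Lemma iter_step_halted (M : machine) (c : config M) (j k : nat) :
  halted (iter j (@step M) c) -> halted (iter k (@step M) c) ->
  iter j (@step M) c = iter k (@step M) c.
Proof.
(* Halted configurations are fixed by [step], so running past the first halting time changes
   nothing. *)
have stuck m d : halted d -> iter m (@step M) d = d.
  by move=> hd; elim: m => //= m ->; rewrite /step hd.
move=> hj hk; have [jk|/ltnW kj] := leqP j k.
  by rewrite -(subnK jk) iterD (stuck _ _ hj).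
by rewrite -(subnK kj) iterD (stuck _ _ hk).
Qed.

Lemma output_unique (M : machine) (c : config M) (z1 z2 : seq bool) :
  output c z1 -> output c z2 -> z1 = z2.
Proof.
move=> [b1 e1] [b2 e2]; have sz : size z1 = size z2.
  (* Otherwise the cell just after the shorter output would both hold a bit and not hold one. *)
  have [lt|lt|//] := ltngtP (size z1) (size z2).
    by have /e1 := b2 _ lt.
  by have /e2 := b1 _ lt.
apply: (@eq_from_nth _ false) => // j jz.
by have := b1 j jz; rewrite b2 -?sz// => -[].
Qed.

Lemma computes_unique (M : machine) (p x s z1 z2 : seq bool) :
  computes M p x s z1 -> computes M p x s z2 -> z1 = z2.
Proof.
move=> [j [hj oj]] [k [hk ok]]; apply: output_unique ok.
by rewrite -(iter_step_halted hj hk).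
Qed.

(** * Shortest programs and the total mass of [2^-K] *)

Section Kolmogorov.
Variables (R : realType) (U : machine) (P : set (seq bool)).

Definition program (m : nat) (x s p : seq bool) : Prop :=
  P p /\ exists2 z, computes U p x s z & nat_of_str z = m.

(** Program lengths are natural numbers, so the infimum over a nonempty set of them is a minimum. *)
Lemma Kcond_attained (m : nat) (x s p : seq bool) : program m x s p ->
  exists2 q, program m x s q & Kcond R U P m x s = ((size q)%:R)%:E.
Proof.
move=> hp.
have ex : exists k, `[< exists2 q, program m x s q & size q = k >].
  by exists (size p); apply/asboolP; exists p.
case: (ex_minnP ex) => _ /asboolP[q hq <-] qmin; exists q => //.
apply/eqP; rewrite eq_le; apply/andP; split.
  by apply: ereal_inf_lbound; exists q.
apply: le_ereal_inf_tmp => _ [r hr <-].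
by rewrite lee_fin ler_nat; apply: qmin; apply/asboolP; exists r.
Qed.

Lemma pow2N_ge0 (k : \bar R) : 0 <= pow2N k.
Proof. by case: k => //= r; exact: powR_ge0. Qed.

(** Kraft's inequality is applied to one shortest program per index; these are distinct because a
    program has at most one output. *)
Lemma sum_pow2N_Kcond (n : nat) (x s : seq bool) : prefix_free P ->
  \sum_(i < n) pow2N (Kcond R U P i.+1 x s) <= 1.
Proof.
move=> hP.
pose A := [pred i : 'I_n | `[< exists p, program i.+1 x s p >]].
have shortest (i : 'I_n) : exists q, A i ->
    program i.+1 x s q /\ Kcond R U P i.+1 x s = ((size q)%:R)%:E.
  have [/asboolP[p /Kcond_attained[q]]|_] := boolP (A i); last by exists [::].
  by exists q.
have [p hp] := choice shortest.
(* An index without a program has complexity [+oo], which [pow2N] sends to 0. *)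
rewrite (bigID A)/= [X in _ + X]big1 ?addr0; last first.
  move=> i /asboolPn Ai; rewrite /Kcond [X in ereal_inf X](_ : _ = set0).
    by rewrite ereal_inf0.
  by rewrite -subset0 => y [q hq _]; apply: Ai; exists q.
rewrite (eq_bigr (fun i => 2^-1 ^+ size (p i))) => [|i Ai]; last first.
  by rewrite (hp i Ai).2/= powRN powR_mulrn// exprVn.
apply: (@kraft R P _ A p hP) => [i Ai|i j Ai Aj pij].
  by have [[]] := hp i Ai.
have [[_ [z1 c1 m1]] _] := hp i Ai; have [[_ [z2 c2 m2]] _] := hp j Aj.
rewrite pij in c1; apply/val_inj/succn_inj.
by rewrite -m1 -m2 (computes_unique c1 c2).
Qed.

End Kolmogorov.

(** * Comparison of the adversary bounds *)

Section Comparison.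
Variables (R : realType) (n : nat) (S : {set n.-tuple bool}).
Variable f : dom S -> bool.

Lemma CA1_le_CA : (CA1 R f <= CA R f)%E.
Proof. by apply: ereal_sup_le => _ [r [hr _] <-]; exists r. Qed.

Lemma CA_le_WA : (CA R f <= WA R f)%E.
Proof.
apply: ereal_sup_le => _ [r [rC r0 rn0 rf] <-].
(* With this choice [vt r'] is the denominator of [theta r], so both schemes have the same value. *)
pose r' (x y : dom S) i := if bit x i != bit y i then r x y else 0.
exists (r, r').
  split=> // [x y i|x y i xy]; last by rewrite /r' xy eq_sym xy rC.
  split=> [|[xy|xy]]; rewrite /r'; last by rewrite rf// if_same.
    by case: ifP.
  by rewrite xy eqxx.
rewrite /WA_value /CA_value; congr ereal_inf; apply/seteqP.
have thetaE x i : theta r x i = wt r x / vt r' x i.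
  by rewrite /theta /wt /vt -big_mkcond.
by split=> e [x [y [i [rxy xyi ->]]]]; exists x, y, i; split;
  rewrite ?thetaE//; move: rxy; rewrite lt0r r0 andbT.
Qed.

End Comparison.

(** * The function on unit vectors and its fractional block sensitivity *)

Section UnitVectors.
Variable m : nat.

Definition unit_tuple (i : 'I_(m + m)) : (m + m).-tuple bool :=
  [tuple i == j | j < m + m].

Definition unit_tuples : {set (m + m).-tuple bool} :=
  finset (mem (codom unit_tuple)).

Fact unit_tuple_in (i : 'I_(m + m)) : unit_tuple i \in unit_tuples.
Proof. by rewrite inE; exact: codom_f. Qed.

Definition unit_vector (i : 'I_(m + m)) : dom unit_tuples :=
  exist _ (unit_tuple i) (unit_tuple_in i).

Lemma bit_unit_vector (i j : 'I_(m + m)) : bit (unit_vector i) j = (i == j).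
Proof. by rewrite /bit tnth_mktuple. Qed.

Definition lower (x : dom unit_tuples) : bool :=
  [exists i : 'I_(m + m), (i < m)%N && bit x i].

Lemma lower_unit_vector (i : 'I_(m + m)) : lower (unit_vector i) = (i < m)%N.
Proof.
apply/existsP/idP => [[j /andP[jm]]|im].
  by rewrite bit_unit_vector => /eqP ->.
by exists i; rewrite im bit_unit_vector eqxx.
Qed.

Lemma unit_vectorP (x : dom unit_tuples) : exists i, x = unit_vector i.
Proof.
case: x => t tU; have := tU; rewrite inE => /codomP[i ti].
by exists i; apply: val_inj.
Qed.

Lemma unit_vector_inj : injective unit_vector.
Proof.
move=> i j /(congr1 (fun x => bit x j)).
by rewrite !bit_unit_vector eqxx => /eqP.
Qed.

Lemma unit_vector_bij : bijective unit_vector.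
Proof.
have [g gK] := choice unit_vectorP.
by exists g => // i; apply: unit_vector_inj; rewrite -gK.
Qed.

Lemma lower_lshift (i : 'I_m) : lower (unit_vector (lshift m i)) = true.
Proof. by rewrite lower_unit_vector/= ltn_ord. Qed.

Lemma lower_rshift (i : 'I_m) : lower (unit_vector (rshift m i)) = false.
Proof. by rewrite lower_unit_vector/= ltnNge leq_addr. Qed.

Lemma fbs_lower (R : realType) : (fbs R lower <= 1%:E)%E.
Proof.
apply/ereal_supP => _ [x _ <-]; apply/ereal_supP => _ [w [w01 wi] <-].
have [i xi] := unit_vectorP x; rewrite xi {x xi w01} in wi *.
rewrite lee_fin; apply: le_trans (wi i).
(* Every sensitive block contains [i], so the packing constraint at [i] bounds the whole sum. *)
rewrite (eq_bigl (fun B => sensitive_block lower (unit_vector i) B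
                           && (i \in B)))// => B.
apply/esym/andb_idr => sB.
have /existsP[y /andP[fy /eqP ->]] := sB.
have [j yj] := unit_vectorP y; rewrite yj in fy *.
rewrite inE !bit_unit_vector eqxx eq_sym eqb_id.
by apply: contraNneq fy => ->.
Qed.

(** * Adversary and minimax lower bounds for [lower] *)

Section Bounds.
Variable R : realType.

Definition cross (x y : dom unit_tuples) : R := (lower x != lower y)%:R.

Lemma sum_cross (a : 'I_(m + m)) : \sum_y cross (unit_vector a) y = m%:R.
Proof.
rewrite (reindex _ (onW_bij _ unit_vector_bij))/= big_split_ord/= /cross.
under eq_bigr do rewrite lower_lshift.
under [X in _ + X]eq_bigr do rewrite lower_rshift.
rewrite !sumr_const card_ord.
by case: (lower _); rewrite /= mul0rn ?addr0 ?add0r.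
Qed.

Lemma theta_cross (a b : 'I_(m + m)) :
  lower (unit_vector a) != lower (unit_vector b) ->
  theta cross (unit_vector a) b = m%:R.
Proof.
move=> ab; rewrite /theta sum_cross.
have ab' : a != b by apply: contraNneq ab => ->.
rewrite (reindex _ (onW_bij _ unit_vector_bij))/= (big_pred1 b) => [|c].
  by rewrite /cross ab divr1.
by rewrite !bit_unit_vector (negbTE ab') /=; case: (c == b).
Qed.

Lemma CA1_lower_ge : (0 < m)%N -> ((m%:R)%:E <= CA1 R lower)%E.
Proof.
move=> m0; have crossC x y : cross x y = cross y x by rewrite /cross eq_sym.
apply: le_ereal_sup_tmp; exists (CA_value cross).
  exists cross => //; split.
    split=> [//|x y||x y].
    - by rewrite ler0n.
    - exists (unit_vector (lshift m (Ordinal m0))).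
      exists (unit_vector (rshift m (Ordinal m0))).
      by rewrite /cross lower_lshift lower_rshift oner_eq0.
    - by rewrite /cross => ->; rewrite eqxx.
  (* With the indicators of the two values, one of the two products is 1 exactly when the values
     differ. *)
  exists (fun x => (lower x)%:R), (fun x => (~~ lower x)%:R); split.
  - by move=> x; rewrite ler0n.
  - by move=> x; rewrite ler0n.
  - by move=> x y ->; rewrite -natrM mulnb andbN.
  - move=> x y; rewrite /cross.
    by case: (lower x) (lower y) => -[]; rewrite /= ?mulr1 ?mulr0 ?mul0r
      ?maxxx ?(max_l ler01) ?(max_r ler01).
apply/ereal_infP => _ [x [y [i [xy xyi ->]]]]; rewrite lee_fin le_max.
have [a xa] := unit_vectorP x; have [b yb] := unit_vectorP y.
rewrite {x}xa {y}yb in xy xyi *.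
have ab : lower (unit_vector a) != lower (unit_vector b).
  by move: xy; rewrite /cross; case: (_ != _); rewrite ?ltxx.
(* At [i = b] the ratio of [unit_vector a] is [m], at [i = a] that of [unit_vector b]; one suffices
   for the maximum. *)
have : i = a \/ i = b.
  move: xyi; rewrite !bit_unit_vector.
  by case: (a =P i) => [->|_]; [left|case: (b =P i) => [->|//]; right].
case=> ->; last by rewrite (theta_cross ab) lexx.
by rewrite (@theta_cross b a) ?lexx ?orbT// eq_sym.
Qed.

Lemma minimax_lower_ge (g : dom unit_tuples -> 'I_(m + m) -> R) :
    (0 < m)%N -> (forall x i, 0 <= g x i) -> (forall x, \sum_i g x i <= 1) ->
  ((m%:R / 2)%:E <= minimax_value lower g)%E.
Proof.
move=> m0 g0 g1.
pose x (i : 'I_m) := unit_vector (lshift m i).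
pose y (j : 'I_m) := unit_vector (rshift m j).
have xy i j : lower (x i) != lower (y j).
  by rewrite lower_lshift lower_rshift.
pose D i j := \sum_(k | bit (x i) k != bit (y j) k)
  Num.min (g (x i) k) (g (y j) k).
have D0 i j : 0 <= D i j by apply: sumr_ge0 => k _; rewrite le_min !g0.
(* At each of the two differing indices, the minimum is bounded by the mass from the vector whose
   bit there is 0. *)
have DE i j : D i j <= g (y j) (lshift m i) + g (x i) (rshift m j).
  rewrite /D (bigD1 (lshift m i))/=; last first.
    by rewrite !bit_unit_vector eqxx eq_rlshift.
  rewrite (big_pred1 (rshift m j)) => [|k].
    by rewrite lerD// ge_min lexx ?orbT.
  rewrite !bit_unit_vector !(eq_sym _ k) /=.
  have [->|_] := eqVneq k (lshift m i); first by rewrite !eq_lrshift.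
  by rewrite /= andbT; case: (k == _).
(* Otherwise the sum over all pairs exceeds [2m]. It is at most [2m], since for each fixed vector
   the masses on the opposite half sum to at most 1. *)
have [i [j Dij]] : exists i j, D i j <= 2 / m%:R.
  apply: contrapT => noD.
  have : \sum_(i < m) \sum_(j < m) (2 / m%:R : R) <
      \sum_(i < m) \sum_(j < m)
        (g (y j) (lshift m i) + g (x i) (rshift m j)).
    have hasm : has predT (index_enum 'I_m).
      by apply/hasP; exists (Ordinal m0); rewrite ?mem_index_enum.
    apply: ltr_sum => // i _; apply: ltr_sum => // j _.
    apply: lt_le_trans (DE i j); rewrite ltNge; apply/negP => Dij.
    by apply: noD; exists i, j.
  apply/negP; rewrite -leNgt.
  under eq_bigr do rewrite big_split/=.
  rewrite big_split/= exchange_big/=.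
  have half z : \sum_(i < m) g z (lshift m i) <= 1 /\
      \sum_(i < m) g z (rshift m i) <= 1.
    have := g1 z; rewrite big_split_ord/= => gz.
    by split; apply: le_trans gz; rewrite ?lerDl ?lerDr; apply: sumr_ge0.
  rewrite !sumr_const card_ord -(mulr_natr (2 / _)) divfK ?pnatr_eq0 -?lt0n//.
  have sum_le (F : 'I_m -> R) : (forall i, F i <= 1) -> \sum_i F i <= m%:R.
    move=> F1; rewrite -[m in leRHS]card_ord -sumr_const.
    by apply: ler_sum => i _; exact: F1.
  by rewrite mulrnDl lerD// sum_le// => i;
    have [] := half (x i); have [] := half (y i).
apply: le_ereal_sup_tmp; exists (((D i j)%:E)^-1)%E.
  by exists (x i), (y j).
(* If [D i j] is 0, its inverse is [+oo] and the bound is immediate. *)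
rewrite inver; case: eqP => [_|/eqP Dn0]; first by rewrite leey.
rewrite lee_fin -[leLHS]invrK invf_div lef_pV2// posrE ?divr_gt0// ?ltr0n//.
by rewrite lt0r Dn0 D0.
Qed.

End Bounds.
End UnitVectors.

Theorem theorem2 (R : realType) (U : machine) (P : set (seq bool))
    (hU : universal U P) :
  exists c C : R, (0 < c)%R /\ (0 < C)%R /\
    forall n : nat, (0 < n)%N -> ~~ odd n ->
      exists (S : {set n.-tuple bool}) (f : dom S -> bool),
        (fbs R f <= C%:E)%E /\
        ((c * n%:R)%:E <= CA1 R f)%E /\
        ((c * n%:R)%:E <= CA R f)%E /\
        ((c * n%:R)%:E <= WA R f)%E /\
        ((c * n%:R)%:E <= KA R U P f)%E /\
        ((c * n%:R)%:E <= MM R f)%E.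
Proof.
(* The weakest lower bound is the minimax one, [m / 2], which is [n / 4] for [n = 2m]. *)
exists (4^-1), 1; split; first by rewrite invr_gt0.
split=> [//|n n0 n_even].
have [m nE] : exists m, n = (m + m)%N.
  by exists n./2; rewrite addnn even_halfK.
have m0 : (0 < m)%N by move: n0; rewrite nE; case: (m).
rewrite {n n0 n_even}nE.
have -> : 4^-1 * (m + m)%:R = m%:R / 2 :> R by rewrite natrD; lra.
exists (unit_tuples m), (@lower m).
have CA1_ge : ((m%:R / 2)%:E <= CA1 R (@lower m))%E.
  apply: le_trans (CA1_lower_ge R m0); rewrite lee_fin.
  by have := ler0n R m; lra.
have CA_ge := le_trans CA1_ge (CA1_le_CA R (@lower m)).
have WA_ge := le_trans CA_ge (CA_le_WA R (@lower m)).
split; first exact: fbs_lower.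
do 3![split; first by []].
split; apply/ereal_infP => y.
  move=> [s _ <-]; apply: minimax_lower_ge => // x.
    by move=> i; exact: pow2N_ge0.
  by apply: sum_pow2N_Kcond; case: hU.
by move=> [p hp <-]; apply: minimax_lower_ge => // x; have [p0 p1] := hp x;
  rewrite ?p1.
Qed.
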